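(* Let $K$ be a field of characteristic different from $2$ and $3$ and let $N$ be a Malcev superalgebra over $K$, regarded as an Akivis superalgebra with trilinear map $A(x,y,z)=\frac16 SJ(x,y,z)$. Let $\tilde U(N)=\tilde T(N)/I$ be its universal enveloping superalgebra as an Akivis superalgebra, and $\tilde T(N)/\tilde I$ its classical enveloping superalgebra as a Malcev superalgebra. Then $I\subseteq\tilde I$, and consequently $\tilde T(N)/\tilde I$ is an epimorphic image of $\tilde U(N)$ via the surjective superalgebra homomorphism $\tilde\mu:\tilde T(N)/I\to\tilde T(N)/\tilde I$, $\tilde\mu(n+I)=n+\tilde I$ for all $n\in\tilde T(N)$.
   Context: A superalgebra is a (not necessarily associative) $\mathbb{Z}_2$-graded algebra over $K$. A Malcev superalgebra is a superalgebra $N=N_0\oplus N_1$ whose Grassmann envelope is a Malcev algebra; its product is written $[\,,\,]$. For homogeneous $x\in N_\alpha,y\in N_\beta,z\in N_\gamma$ the superjacobian is $$SJ(x,y,z)=[[x,y],z]+(-1)^{\alpha(\beta+\gamma)}[[y,z],x]+(-1)^{\gamma(\alpha+\beta)}[[z,x],y].$$ $\tilde T(N)=\bigoplus_{n\ge 0}\tilde T^n(N)$ is the nonassociative tensor algebra: $\tilde T^0(N)=K$, $\tilde T^1(N)=N$, $\tilde T^n(N)=\bigoplus_{i=1}^{n-1}\tilde T^i(N)\otimes\tilde T^{n-i}(N)$ for $n\ge2$, with multiplication $xy=x\otimes y$ (elements of $K$ acting by scalar multiplication) and the $\mathbb{Z}_2$-grading induced from $N$. Write $(x,y,z)=(xy)z-x(yz)$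 for the associator in $\tilde T(N)$. $I$ is the two-sided ideal of $\tilde T(N)$ generated by $x\otimes y-(-1)^{\alpha\beta}y\otimes x-[x,y]$ and $(x\otimes y)\otimes z-x\otimes(y\otimes z)-A(x,y,z)$ for all $x\in N_\alpha,y\in N_\beta,z\in N_\gamma$, $\alpha,\beta,\gamma\in\mathbb{Z}_2$. $\tilde I$ is the two-sided ideal of $\tilde T(N)$ generated by the elements $$a\otimes b-(-1)^{\alpha\beta}b\otimes a-[a,b],\qquad (a,x,y)+(-1)^{\alpha\gamma}(x,a,y),\qquad (x,a,y)+(-1)^{\alpha\xi}(x,y,a)$$ for all $a\in N_\alpha,b\in N_\beta,x\in\tilde T(N)_\gamma,y\in\tilde T(N)_\xi$, $\alpha,\beta,\gamma,\xi\in\mathbb{Z}_2$. *)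

(* Defs.v *)
From HB Require Import structures.
From mathcomp Require Import all_boot ssralg ring_quotient.
From mathcomp Require Import finmap boolp.

Set Implicit Arguments.
Unset Strict Implicit.
Unset Printing Implicit Defensive.

Import GRing.Theory.

Local Open Scope ring_scope.
Local Open Scope quotient_scope.

Section Subspaces.
Variables (K : fieldType) (V : lmodType K).

Definition is_subspace (S : V -> Prop) : Prop :=
  S 0 /\ forall (k : K) x y, S x -> S y -> S (k *: x + y).

Definition span (P : V -> Prop) (x : V) : Prop :=
  forall S, is_subspace S -> (forall y, P y -> S y) -> S x.

Lemma subspaceD S x y : is_subspace S -> S x -> S y -> S (x + y).
Proof. by case=> _ h sx sy; rewrite -[x]scale1r; apply: h. Qed.

Lemma subspaceZ S k x : is_subspace S -> S x -> S (k *: x).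
Proof. by case=> s0 h sx; rewrite -[_ *: _]addr0; apply: h. Qed.

Lemma subspaceN S x : is_subspace S -> S x -> S (- x).
Proof. by move=> hS sx; rewrite -scaleN1r; apply: subspaceZ. Qed.

Lemma subspaceB S x y : is_subspace S -> S x -> S y -> S (x - y).
Proof. by move=> hS sx sy; apply: subspaceD => //; apply: subspaceN. Qed.

Lemma subspace_sum S (J : Type) (r : seq J) (P : pred J) (F : J -> V) :
  is_subspace S -> (forall j, P j -> S (F j)) -> S (\sum_(j <- r | P j) F j).
Proof.
move=> hS hF; apply: (big_ind S) => //; first by case: hS.
by move=> x y; apply: subspaceD.
Qed.

Lemma span_subspace P : is_subspace (span P).
Proof.
split=> [S [] // | k x y hx hy S hS hP].
by case: (hS) => _; apply; [apply: hx | apply: hy].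
Qed.

Lemma span_gen (P : V -> Prop) x : P x -> span P x.
Proof. by move=> px S _; apply. Qed.

Record subspace := Subspace { in_sub :> V -> Prop; subP : is_subspace in_sub }.

Definition span_sub (P : V -> Prop) : subspace := Subspace (span_subspace P).

Variable S : subspace.

Definition sub_mem : {pred V} := fun x => `[< S x >].

Lemma sub_mem_closed : zmod_closed sub_mem.
Proof.
split; first by apply/asboolP; case: (subP S).
move=> x y /asboolP sx /asboolP sy; apply/asboolP.
by apply: subspaceB => //; apply: subP.
Qed.

HB.instance Definition _ := GRing.isZmodClosed.Build V sub_mem sub_mem_closed.

Definition lquot : Type := Quotient.quot sub_mem.

HB.instance Definition _ := GRing.Zmodule.on lquot.

Definition lpi (x : V) : lquot := \pi_(Quotient.quot sub_mem) x.

Definition lrepr (q : lquot) : V := repr (q : Quotient.quot sub_mem).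

Lemma lreprK : cancel lrepr lpi.
Proof. by move=> q; rewrite /lpi /lrepr reprK. Qed.

Lemma lpi_eq x y : lpi x = lpi y <-> S (x - y).
Proof.
have e := Quotient.idealrBE sub_mem x y.
split=> [/eqP h | /asboolP h]; first by apply/asboolP; move: h; rewrite -e.
by apply/eqP; rewrite -[X in is_true X]e.
Qed.

Lemma lpiD x y : lpi (x + y) = lpi x + lpi y.
Proof. by rewrite /lpi raddfD. Qed.

Definition lquot_scale (k : K) (q : lquot) : lquot := lpi (k *: lrepr q).

Lemma lquot_scaleE k x : lquot_scale k (lpi x) = lpi (k *: x).
Proof.
apply/lpi_eq; rewrite -scalerBr; apply: subspaceZ; first exact: subP.
by apply/lpi_eq; rewrite lreprK.
Qed.

Fact lquot_scaleA k l q :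
  lquot_scale k (lquot_scale l q) = lquot_scale (k * l) q.
Proof. by rewrite -[q]lreprK !lquot_scaleE scalerA. Qed.

Fact lquot_scale1 : left_id 1 lquot_scale.
Proof. by move=> q; rewrite -[q]lreprK lquot_scaleE scale1r. Qed.

Fact lquot_scaleDr : right_distributive lquot_scale +%R.
Proof.
move=> k q r; rewrite -[q]lreprK -[r]lreprK -lpiD !lquot_scaleE.
by rewrite scalerDr lpiD.
Qed.

Fact lquot_scaleDl q : {morph lquot_scale^~ q : k l / k + l}.
Proof. by move=> k l; rewrite -[q]lreprK !lquot_scaleE scalerDl lpiD. Qed.

HB.instance Definition _ := GRing.Zmodule_isLmodule.Build K lquot
  lquot_scaleA lquot_scale1 lquot_scaleDr lquot_scaleDl.

Lemma lpi_linear : linear lpi.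
Proof. by move=> k x y; rewrite lpiD -lquot_scaleE. Qed.

HB.instance Definition _ := GRing.isLinear.Build K V lquot *:%R lpi lpi_linear.

Lemma lpi_eq0 x : lpi x = 0 <-> S x.
Proof. by rewrite -(raddf0 lpi) lpi_eq subr0. Qed.

End Subspaces.

Definition is_bilinear (K : fieldType) (U V W : lmodType K) (f : U -> V -> W) :=
  (forall y, linear (f^~ y)) /\ (forall x, linear (f x)).

Section LinearFacts.
Variable K : fieldType.
Implicit Types U V W : lmodType K.

Lemma lin0 U V (f : U -> V) : linear f -> f 0 = 0.
Proof.
by move=> h; have := h (-1) 0 0; rewrite !scaleN1r !oppr0 addr0 addNr.
Qed.

Lemma linD U V (f : U -> V) x y : linear f -> f (x + y) = f x + f y.
Proof. by move=> h; have := h 1 x y; rewrite !scale1r. Qed.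

Lemma linZ U V (f : U -> V) k x : linear f -> f (k *: x) = k *: f x.
Proof. by move=> h; have := h k x 0; rewrite (lin0 h) !addr0. Qed.

Lemma linN U V (f : U -> V) x : linear f -> f (- x) = - f x.
Proof. by move=> h; rewrite -scaleN1r linZ // scaleN1r. Qed.

Lemma linB U V (f : U -> V) x y : linear f -> f (x - y) = f x - f y.
Proof. by move=> h; rewrite linD // linN. Qed.

Lemma lin_sum U V (f : U -> V) J (r : seq J) (P : pred J) F : linear f ->
  f (\sum_(j <- r | P j) F j) = \sum_(j <- r | P j) f (F j).
Proof.
by move=> h; apply: (big_morph f (fun x y => linD x y h)); apply: lin0.
Qed.

Lemma lin_ker U V (f : U -> V) : linear f -> is_subspace (fun x => f x = 0).
Proof.
by move=> h; split=> [|k x y fx fy]; rewrite ?lin0 // h fx fy scaler0 addr0.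
Qed.

Lemma lin_eq U V (f g : U -> V) :
  linear f -> linear g -> is_subspace (fun x => f x = g x).
Proof.
by move=> hf hg; split=> [|k x y fx fy]; rewrite ?(lin0 hf) ?(lin0 hg) // hf hg fx fy.
Qed.

End LinearFacts.

Section DirectSum.
Variables (K : fieldType) (I : eqType) (V : I -> lmodType K).

Record dsum := DSum {
  dval :> forall i, V i;
  dfin : exists s : seq I, forall i, i \notin s -> dval i = 0 }.

Lemma dsumP (u v : dsum) : (forall i, u i = v i) -> u = v.
Proof.
case: u v => [f hf] [g hg] /= fg.
have e : f = g by apply: functional_extensionality_dep.
by case: g / e hg {fg} => hg; congr DSum; apply: Prop_irrelevance.
Qed.

HB.instance Definition _ := gen_eqMixin dsum.
HB.instance Definition _ := gen_choiceMixin dsum.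

Fact dzero_fin :
  exists s : seq I, forall i, i \notin s -> (fun i => 0 : V i) i = 0.
Proof. by exists [::]. Qed.
Definition dzero := DSum dzero_fin.

Fact dopp_fin (u : dsum) :
  exists s : seq I, forall i, i \notin s -> (fun i => - u i) i = 0.
Proof. by case: u => f [s hs] /=; exists s => i /hs ->; rewrite oppr0. Qed.
Definition dopp u := DSum (dopp_fin u).

Fact dadd_fin (u v : dsum) :
  exists s : seq I, forall i, i \notin s -> (fun i => u i + v i) i = 0.
Proof.
case: u v => f [s hs] [g [t ht]] /=; exists (s ++ t) => i.
by rewrite mem_cat negb_or => /andP[/hs -> /ht ->]; rewrite addr0.
Qed.
Definition dadd u v := DSum (dadd_fin u v).

Fact dscale_fin (k : K) (u : dsum) :
  exists s : seq I, forall i, i \notin s -> (fun i => k *: u i) i = 0.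
Proof. by case: u => f [s hs] /=; exists s => i /hs ->; rewrite scaler0. Qed.
Definition dscale k u := DSum (dscale_fin k u).

Fact daddA : associative dadd.
Proof. by move=> u v w; apply: dsumP => i /=; rewrite addrA. Qed.
Fact daddC : commutative dadd.
Proof. by move=> u v; apply: dsumP => i /=; rewrite addrC. Qed.
Fact dadd0 : left_id dzero dadd.
Proof. by move=> u; apply: dsumP => i /=; rewrite add0r. Qed.
Fact daddN : left_inverse dzero dopp dadd.
Proof. by move=> u; apply: dsumP => i /=; rewrite addNr. Qed.
HB.instance Definition _ := GRing.isZmodule.Build dsum daddA daddC dadd0 daddN.

Fact dscaleA k l u : dscale k (dscale l u) = dscale (k * l) u.
Proof. by apply: dsumP => i /=; rewrite scalerA. Qed.
Fact dscale1 : left_id 1 dscale.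
Proof. by move=> u; apply: dsumP => i /=; rewrite scale1r. Qed.
Fact dscaleDr : right_distributive dscale +%R.
Proof. by move=> k u v; apply: dsumP => i /=; rewrite scalerDr. Qed.
Fact dscaleDl u : {morph dscale^~ u : k l / k + l}.
Proof. by move=> k l; apply: dsumP => i /=; rewrite scalerDl. Qed.
HB.instance Definition _ := GRing.Zmodule_isLmodule.Build K dsum
  dscaleA dscale1 dscaleDr dscaleDl.

Definition dinj_val i (x : V i) j : V j :=
  if i =P j is ReflectT e then ecast i (V i) e x else 0.

Fact dinj_fin i (x : V i) :
  exists s : seq I, forall j, j \notin s -> dinj_val x j = 0.
Proof.
exists [:: i] => j nj; rewrite /dinj_val; case: eqP => // e.
by case/negP: nj; rewrite inE e.
Qed.

Definition dinj i (x : V i) : dsum := DSum (dinj_fin x).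

Lemma dinj_eq i (x : V i) : dinj x i = x.
Proof. by rewrite /= /dinj_val; case: eqP => // e; rewrite eq_axiomK. Qed.

Lemma dinj_neq i j (x : V i) : i != j -> dinj x j = 0.
Proof. by rewrite /= /dinj_val; case: eqP. Qed.

Lemma dinj_linear i : linear (@dinj i).
Proof.
move=> k x y; apply: dsumP => j /=; rewrite /dinj_val; case: eqP => [e|_].
  by case: j / e.
by rewrite scaler0 addr0.
Qed.

Lemma dval_linear i : linear (fun u : dsum => u i).
Proof. by []. Qed.

Definition dsupp (u : dsum) : seq I := undup (sval (cid (dfin u))).

Lemma dsupp_uniq u : uniq (dsupp u).
Proof. exact: undup_uniq. Qed.

Lemma dsuppP (u : dsum) i : i \notin dsupp u -> u i = 0.
Proof. by rewrite mem_undup; case: cid => s /= hs /hs. Qed.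

(* for linear f i, the linear map whose restriction to each V i is f i *)
Definition dlift (U : lmodType K) (f : forall i, V i -> U) (u : dsum) : U :=
  \sum_(i <- dsupp u) f i (u i).

Section Lift.
Variables (U : lmodType K) (f : forall i, V i -> U).
Hypothesis hf : forall i, linear (@f i).

Lemma dlift_supp (u : dsum) s : uniq s -> (forall i, i \notin s -> u i = 0) ->
  dlift f u = \sum_(i <- s) f (u i).
Proof.
have aux r : \sum_(i <- r) f (u i) = \sum_(i <- [seq i <- r | u i != 0]) f (u i).
  rewrite big_filter [RHS]big_mkcond; apply: eq_bigr => i _.
  by case: eqP => //= ->; rewrite lin0.
move=> us hs; rewrite /dlift aux [RHS]aux; apply: perm_big; apply: uniq_perm.
- by rewrite filter_uniq // dsupp_uniq.
- by rewrite filter_uniq.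
move=> i; rewrite !mem_filter; case: eqP => //= ui.
have -> : i \in dsupp u by apply: contraT => /dsuppP /ui.
by apply/esym; apply: contraT => /hs /ui.
Qed.

Lemma dlift_linear : linear (dlift f).
Proof.
move=> k u v; pose s := undup (dsupp u ++ dsupp v).
have us : uniq s by apply: undup_uniq.
have hu i : i \notin s -> u i = 0.
  by rewrite mem_undup mem_cat negb_or => /andP[/dsuppP].
have hv i : i \notin s -> v i = 0.
  by rewrite mem_undup mem_cat negb_or => /andP[_ /dsuppP].
rewrite (dlift_supp us hu) (dlift_supp us hv) (dlift_supp us).
  by rewrite scaler_sumr -big_split; apply: eq_bigr => i _; apply: hf.
by move=> i si /=; rewrite hu // hv // scaler0 addr0.
Qed.

Lemma dlift_inj i (x : V i) : dlift f (dinj x) = f x.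
Proof.
rewrite (@dlift_supp _ [:: i]) //; first by rewrite big_seq1 dinj_eq.
by move=> j; rewrite inE eq_sym => /dinj_neq.
Qed.

End Lift.

Lemma dsum_decomp (u : dsum) : u = \sum_(i <- dsupp u) dinj (u i).
Proof.
apply: dsumP => j.
have -> : (\sum_(i <- dsupp u) dinj (u i)) j = \sum_(i <- dsupp u) dinj (u i) j.
  exact: (lin_sum _ _ _ (@dval_linear j)).
have [js|js] := boolP (j \in dsupp u).
  rewrite (bigD1_seq j) ?dsupp_uniq // dinj_eq big1 => [|i].
    by rewrite /= addr0.
  exact: dinj_neq.
rewrite dsuppP // big_seq big1 // => i si; apply: dinj_neq.
by apply: contraNneq js => <-.
Qed.

Lemma dsum_ind (P : dsum -> Prop) :
  is_subspace P -> (forall i (x : V i), P (dinj x)) -> forall u, P u.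
Proof. by move=> hP h u; rewrite (dsum_decomp u); apply: subspace_sum. Qed.

End DirectSum.

Section DirectSumBilinear.
Variables (K : fieldType) (I J : eqType).
Variables (V : I -> lmodType K) (W : J -> lmodType K) (U : lmodType K).
Variable f : forall i j, V i -> W j -> U.

(* for bilinear f i j, the bilinear map whose restriction to V i x W j is f i j *)
Definition dlift2 (u : dsum V) (v : dsum W) : U :=
  dlift (fun i x => dlift (fun j y => f x y) v) u.

Hypothesis hf : forall i j, is_bilinear (@f i j).

Let aux (v : dsum W) i : linear (fun x : V i => dlift (fun j y => f x y) v).
Proof.
move=> k x y; rewrite /dlift scaler_sumr -big_split; apply: eq_bigr => j _.
by case: (hf i j) => h _; apply: (h (v j)).
Qed.

Lemma dlift2_bilinear : is_bilinear dlift2.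
Proof.
split=> [v|u]; first by apply: dlift_linear; apply: aux.
move=> k v w; rewrite /dlift2 /dlift scaler_sumr -big_split.
apply: eq_bigr => i _; apply: (@dlift_linear _ _ _ _ (fun j => @f i j (u i))).
by move=> j; case: (hf i j).
Qed.

Lemma dlift2_inj i j (x : V i) (y : W j) : dlift2 (dinj x) (dinj y) = f x y.
Proof.
rewrite /dlift2 dlift_inj; last by move=> i'; apply: aux.
by apply: (@dlift_inj _ _ _ _ (fun j => @f i j x)) => j'; case: (hf i j').
Qed.

End DirectSumBilinear.

Section Tensor.
Variables (K : fieldType) (V W : lmodType K).

Definition free_on (X : eqType) : lmodType K := dsum (fun _ : X => K^o).

Definition fgen (X : eqType) (x : X) : free_on X :=
  @dinj K X (fun=> K^o) x (1 : K^o).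

Definition tensor_relation (t : free_on (V * W)%type) : Prop :=
  (exists k v v' w,
     t = fgen (k *: v + v', w) - (k *: fgen (v, w) + fgen (v', w))) \/
  (exists k v w w',
     t = fgen (v, k *: w + w') - (k *: fgen (v, w) + fgen (v, w'))).

Definition tensor : lmodType K := lquot (span_sub tensor_relation).

Definition pure (v : V) (w : W) : tensor := lpi _ (fgen (v, w)).

Lemma pure_bilinear : is_bilinear pure.
Proof.
split=> [w k v v'|v k w w'] /=; rewrite /pure -lpi_linear; apply/lpi_eq.
  by apply: span_gen; left; exists k, v, v', w.
by apply: span_gen; right; exists k, v, w, w'.
Qed.

(* for bilinear f, the linear map sending pure v w to f v w *)
Definition tlift (U : lmodType K) (f : V -> W -> U) (t : tensor) : U :=
  dlift (fun (p : V * W) (k : K^o) => (k : K) *: f p.1 p.2) (lrepr t).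

Section Lift.
Variables (U : lmodType K) (f : V -> W -> U).
Hypothesis hf : is_bilinear f.

Let F := dlift (fun (p : V * W) (k : K^o) => (k : K) *: f p.1 p.2).

Let F_linear : linear F.
Proof.
by apply: dlift_linear => p k x y; rewrite scalerDl scalerA.
Qed.

Let F_gen v w : F (fgen (v, w)) = f v w.
Proof.
rewrite /F dlift_inj ?scale1r // => p k x y.
by rewrite scalerDl scalerA.
Qed.

Let tliftE t : tlift f (lpi _ t) = F t.
Proof.
apply/eqP; rewrite -subr_eq0 -(linB _ _ F_linear); apply/eqP.
have : span tensor_relation (lrepr (lpi (span_sub tensor_relation) t) - t).
  by apply/(lpi_eq (span_sub tensor_relation)); rewrite lreprK.
move=> h; apply: (h (fun x => F x = 0)); first exact: lin_ker.
case: hf => h1 h2 y [[k [v [v' [w ->]]]]|[k [v [w [w' ->]]]]];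
  rewrite (linB _ _ F_linear) F_linear !F_gen.
  by have /= -> := h1 w k v v'; rewrite subrr.
by have /= -> := h2 v k w w'; rewrite subrr.
Qed.

Lemma tlift_linear : linear (tlift f).
Proof.
by move=> k t u; rewrite -[t]lreprK -[u]lreprK -lpi_linear !tliftE F_linear.
Qed.

Lemma tlift_pure v w : tlift f (pure v w) = f v w.
Proof. by rewrite tliftE F_gen. Qed.

End Lift.

Lemma tensor_ind (P : tensor -> Prop) :
  is_subspace P -> (forall v w, P (pure v w)) -> forall t, P t.
Proof.
move=> hP h t; rewrite -[t]lreprK; move: (lrepr t); apply: dsum_ind.
  by split=> [|k x y px py]; rewrite ?raddf0 ?linearP; case: hP => p0 pD //; apply: pD.
move=> [v w] k; rewrite (_ : dinj _ = k *: fgen (v, w)) ?linearZ /=.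
  by apply: subspaceZ => //; apply: h.
rewrite /fgen -(linZ _ _ (@dinj_linear _ _ (fun=> K^o) (v, w))).
by rewrite -[k *: _]/(k * 1) mulr1.
Qed.

End Tensor.

(* bool encodes Z_2, with addition (+) and multiplication && *)
Record superspace (K : fieldType) := Superspace {
  ss_lmod :> lmodType K;
  part : bool -> ss_lmod -> Prop;
  part_subspace : forall a, is_subspace (part a);
  part_dec : forall x, exists x0 x1,
    [/\ part false x0, part true x1 & x = x0 + x1];
  part_disj : forall x, part false x -> part true x -> x = 0 }.

Section Superspace.
Variables (K : fieldType) (V : superspace K).
Implicit Types x y : V.

Lemma part0 a : part a (0 : V).
Proof. by case: (part_subspace V a). Qed.
Lemma partD a x y : part a x -> part a y -> part a (x + y).
Proof. by apply: subspaceD; apply: part_subspace. Qed.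
Lemma partZ a k x : part a x -> part a (k *: x).
Proof. by apply: subspaceZ; apply: part_subspace. Qed.
Lemma partN a x : part a x -> part a (- x).
Proof. by apply: subspaceN; apply: part_subspace. Qed.
Lemma partB a x y : part a x -> part a y -> part a (x - y).
Proof. by apply: subspaceB; apply: part_subspace. Qed.

Definition hcomp (a : bool) x : V :=
  let x0 := sval (cid (part_dec x)) in if a then x - x0 else x0.

Lemma hcompP a x : part a (hcomp a x).
Proof.
rewrite /hcomp; case: cid => x0 [x1 [h0 h1 e]] /=; case: a => //.
by rewrite e addrC addKr.
Qed.

Lemma hcompD x : hcomp false x + hcomp true x = x.
Proof. by rewrite /hcomp addrC subrK. Qed.

Lemma hcomp_uniq x0 x1 : part false x0 -> part true x1 ->
  hcomp false (x0 + x1) = x0 /\ hcomp true (x0 + x1) = x1.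
Proof.
move=> h0 h1; set x := x0 + x1.
have e : hcomp false x - x0 = x1 - hcomp true x.
  by apply/eqP; rewrite subr_eq addrAC eq_sym subr_eq hcompD addrC.
have z : hcomp false x - x0 = 0.
  apply: part_disj; first by apply: partB => //; apply: hcompP.
  by rewrite e; apply: partB => //; apply: hcompP.
split; first by apply/eqP; rewrite -subr_eq0 z.
by apply/eqP; rewrite eq_sym -subr_eq0 -e z.
Qed.

Lemma hcomp_part a b x : part a x -> hcomp b x = if a == b then x else 0.
Proof.
move=> hx; case: a hx => hx.
  by have [] := hcomp_uniq (part0 false) hx; rewrite add0r; case: b.
by have [] := hcomp_uniq hx (part0 true); rewrite addr0; case: b.
Qed.

Lemma hcomp_id a x : part a x -> hcomp a x = x.
Proof. by move/hcomp_part->; rewrite eqxx. Qed.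

Lemma hcomp_neq a x : part a x -> hcomp (~~ a) x = 0.
Proof. by move/hcomp_part->; case: a. Qed.

Lemma hcomp_linear a : linear (hcomp a).
Proof.
move=> k x y.
have [] := @hcomp_uniq (k *: hcomp false x + hcomp false y)
                       (k *: hcomp true x + hcomp true y).
- by apply: partD; [apply: partZ|]; apply: hcompP.
- by apply: partD; [apply: partZ|]; apply: hcompP.
by rewrite addrACA -scalerDr !hcompD; case: a.
Qed.

End Superspace.

Arguments hcomp : simpl never.

Section Line.
Variables (K : fieldType) (a : bool).

Definition line_part (b : bool) (k : K^o) : Prop := b = a \/ k = 0.

Fact line_subspace b : is_subspace (line_part b).
Proof.
split=> [|k x y]; first by right.
case=> [->|->]; first by left.
by case=> [->|->]; [left | right; rewrite scaler0 addr0].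
Qed.

Fact line_dec (k : K^o) : exists k0 k1,
  [/\ line_part false k0, line_part true k1 & k = k0 + k1].
Proof.
rewrite /line_part; case: a.
  by exists 0, k; rewrite add0r; split; [right|left|].
by exists k, 0; rewrite addr0; split; [left|right|].
Qed.

Fact line_disj (k : K^o) : line_part false k -> line_part true k -> k = 0.
Proof. by case=> [e0|//]; case=> // e1; move: e0; rewrite -e1. Qed.

Definition line : superspace K := Superspace line_subspace line_dec line_disj.
End Line.

Section SuperDirectSum.
Variables (K : fieldType) (I : eqType) (V : I -> superspace K).

Definition dsum_part (a : bool) (u : dsum V) : Prop := forall i, part a (u i).

Fact dsum_part_subspace a : is_subspace (dsum_part a).
Proof.
split=> [i|k u v hu hv i]; first exact: part0.
by apply: partD => //; apply: partZ.
Qed.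

Fact dsum_hcomp_fin a (u : dsum V) :
  exists s : seq I, forall i, i \notin s -> (fun i => hcomp a (u i)) i = 0.
Proof.
case: u => f [s hs] /=; exists s => i /hs ->.
by apply: lin0; apply: hcomp_linear.
Qed.
Definition dsum_hcomp a u := DSum (dsum_hcomp_fin a u).

Fact dsum_part_dec (u : dsum V) : exists u0 u1,
  [/\ dsum_part false u0, dsum_part true u1 & u = u0 + u1].
Proof.
exists (dsum_hcomp false u), (dsum_hcomp true u).
split=> [i|i|]; try exact: hcompP.
by apply: dsumP => i /=; rewrite hcompD.
Qed.

Fact dsum_part_disj (u : dsum V) :
  dsum_part false u -> dsum_part true u -> u = 0.
Proof. by move=> h0 h1; apply: dsumP => i; apply: part_disj. Qed.

Definition super_dsum : superspace K :=
  Superspace dsum_part_subspace dsum_part_dec dsum_part_disj.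

Lemma dinj_part a i (x : V i) :
  part a x -> part (s := super_dsum) a (@dinj _ _ V i x).
Proof.
move=> hx j; have [<-|ij] := eqVneq i j; first by rewrite dinj_eq.
by rewrite dinj_neq //; apply: part0.
Qed.

End SuperDirectSum.

Section SuperTensor.
Variables (K : fieldType) (V W : superspace K).

Definition tensor_part (a : bool) : tensor V W -> Prop :=
  span (fun t => exists b c v w,
    [/\ b (+) c = a, part b v, part c w & t = pure v w]).

Let P a (t : tensor V W) : tensor V W :=
  tlift (fun v w => pure (hcomp false v) (hcomp a w)
                    + pure (hcomp true v) (hcomp (~~ a) w)) t.

Let P_bil a : is_bilinear (fun (v : V) (w : W) =>
  pure (hcomp false v) (hcomp a w) + pure (hcomp true v) (hcomp (~~ a) w)).
Proof.
have [hl hr] := pure_bilinear V W.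
split=> [w k v v'|v k w w'] /=; rewrite !hcomp_linear.
  by have /= -> := hl (hcomp a w); have /= -> := hl (hcomp (~~ a) w);
    rewrite scalerDr addrACA.
by have /= -> := hr (hcomp false v); have /= -> := hr (hcomp true v);
  rewrite scalerDr addrACA.
Qed.

Let P_linear a : linear (P a).
Proof. by apply: tlift_linear; apply: P_bil. Qed.

Let P_pure a v w : P a (pure v w) =
  pure (hcomp false v) (hcomp a w) + pure (hcomp true v) (hcomp (~~ a) w).
Proof. by rewrite /P tlift_pure //; apply: P_bil. Qed.

Lemma pure0l (w : W) : pure (0 : V) w = 0.
Proof. exact: (lin0 ((pure_bilinear V W).1 w)). Qed.

Lemma pure0r (v : V) : pure v (0 : W) = 0.
Proof. exact: (lin0 ((pure_bilinear V W).2 v)). Qed.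

Lemma pureDl (v v' : V) (w : W) : pure (v + v') w = pure v w + pure v' w.
Proof. exact: (linD v v' ((pure_bilinear V W).1 w)). Qed.

Lemma pureDr (v : V) (w w' : W) : pure v (w + w') = pure v w + pure v w'.
Proof. exact: (linD w w' ((pure_bilinear V W).2 v)). Qed.

Lemma pure_part a b (v : V) (w : W) :
  part a v -> part b w -> tensor_part (a (+) b) (pure v w).
Proof. by move=> hv hw; apply: span_gen; exists a, b, v, w. Qed.

Let P_part a b t : tensor_part a t -> P b t = if a == b then t else 0.
Proof.
move=> h; apply: (h (fun t => P b t = if a == b then t else 0)).
  split=> [|k x y]; first by rewrite (lin0 (P_linear b)) if_same.
  by rewrite P_linear => -> ->; case: eqP => _; rewrite // scaler0 addr0.
move=> _ [c [d [v [w [<- hv hw ->]]]]]; rewrite P_pure.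
rewrite !(hcomp_part _ hv) !(hcomp_part _ hw).
by case: b c d {hv hw h} => [] [] [] /=; rewrite ?pure0l ?pure0r ?addr0 ?add0r.
Qed.

Fact tensor_part_subspace a : is_subspace (tensor_part a).
Proof. exact: span_subspace. Qed.

Fact tensor_part_dec (t : tensor V W) : exists t0 t1,
  [/\ tensor_part false t0, tensor_part true t1 & t = t0 + t1].
Proof.
have sub a := tensor_part_subspace a.
pose Q t := exists t0 t1,
  [/\ tensor_part false t0, tensor_part true t1 & t = t0 + t1].
suff : Q t by [].
apply: tensor_ind t => [|v w].
  split=> [|k x y [x0 [x1 [hx0 hx1 ->]]] [y0 [y1 [hy0 hy1 ->]]]].
    by exists 0, 0; split; rewrite ?addr0 //; case: (sub false); case: (sub true).
  exists (k *: x0 + y0), (k *: x1 + y1); split.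
  - by case: (sub false) => _; apply.
  - by case: (sub true) => _; apply.
  by rewrite scalerDr addrACA.
have pp a b := pure_part (hcompP a v) (hcompP b w).
exists (pure (hcomp false v) (hcomp false w) + pure (hcomp true v) (hcomp true w)),
  (pure (hcomp false v) (hcomp true w) + pure (hcomp true v) (hcomp false w)).
split.
- exact: subspaceD (sub false) (pp false false) (pp true true).
- exact: subspaceD (sub true) (pp false true) (pp true false).
by rewrite [X in _ = _ + X]addrC addrACA -!pureDl [hcomp true v + _]addrC -pureDr !hcompD.
Qed.

Fact tensor_part_disj (t : tensor V W) :
  tensor_part false t -> tensor_part true t -> t = 0.
Proof.
move=> h0 h1; have /= e0 := P_part false h0; have /= e1 := P_part false h1.
by rewrite -e0 e1.
Qed.

Definition super_tensor : superspace K :=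
  Superspace tensor_part_subspace tensor_part_dec tensor_part_disj.

End SuperTensor.

Record superalgebra (K : fieldType) := Superalgebra {
  sa_space :> superspace K;
  smul : sa_space -> sa_space -> sa_space;
  smul_bilinear : is_bilinear smul;
  smul_part : forall a b x y,
    part a x -> part b y -> part (a (+) b) (smul x y) }.

Definition superalgebra_hom (K : fieldType) (A B : superalgebra K)
    (f : A -> B) : Prop :=
  [/\ linear f, forall x y, f (smul x y) = smul (f x) (f y)
    & forall a x, part a x -> part a (f x)].

Definition sgn (K : fieldType) (a : bool) : K := (-1) ^+ a.
Arguments sgn {K}.

Section SuperalgebraFacts.
Variables (K : fieldType) (A : superalgebra K).
Implicit Types x y z : A.

Lemma smulDl x y z : smul (x + y) z = smul x z + smul y z.
Proof. exact: (linD x y ((smul_bilinear A).1 z)). Qed.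
Lemma smulDr x y z : smul x (y + z) = smul x y + smul x z.
Proof. exact: (linD y z ((smul_bilinear A).2 x)). Qed.
Lemma smulZl k x y : smul (k *: x) y = k *: smul x y.
Proof. exact: (linZ k x ((smul_bilinear A).1 y)). Qed.
Lemma smulZr k x y : smul x (k *: y) = k *: smul x y.
Proof. exact: (linZ k y ((smul_bilinear A).2 x)). Qed.
Lemma smulBl x y z : smul (x - y) z = smul x z - smul y z.
Proof. exact: (linB x y ((smul_bilinear A).1 z)). Qed.
Lemma smulBr x y z : smul x (y - z) = smul x y - smul x z.
Proof. exact: (linB y z ((smul_bilinear A).2 x)). Qed.

Lemma hcomp_mul c x y : hcomp c (smul x y) =
  smul (hcomp false x) (hcomp c y) + smul (hcomp true x) (hcomp (~~ c) y).
Proof.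
have -> : smul x y = (smul (hcomp false x) (hcomp false y)
    + smul (hcomp false x) (hcomp true y)) + (smul (hcomp true x) (hcomp false y)
    + smul (hcomp true x) (hcomp true y)).
  by rewrite -!smulDr hcompD -smulDl hcompD.
rewrite !(linD _ _ (hcomp_linear c)).
have E a b := hcomp_part c (smul_part (hcompP a x) (hcompP b y)).
by rewrite !E; case: c {E} => /=; rewrite ?addr0 ?add0r.
Qed.

Definition associator x y z : A := smul (smul x y) z - smul x (smul y z).

Lemma associator_part a b c x y z : part a x -> part b y -> part c z ->
  part (a (+) b (+) c) (associator x y z).
Proof.
move=> hx hy hz; apply: partB; first by do !apply: smul_part.
by rewrite -addbA; do !apply: smul_part.
Qed.

Definition is_ideal (J : A -> Prop) : Prop :=
  is_subspace J /\ forall x y, J y -> J (smul x y) /\ J (smul y x).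

Definition ideal_gen (P : A -> Prop) (x : A) : Prop :=
  forall J, is_ideal J -> (forall y, P y -> J y) -> J x.

Lemma ideal_gen_ideal P : is_ideal (ideal_gen P).
Proof.
split=> [|x y hy].
  split=> [J [[]] // | k x y hx hy J hJ hP].
  by case: (hJ) => -[_ h] _; exact: (h k x y (hx J hJ hP) (hy J hJ hP)).
by split=> J hJ hP; case: (hJ) => _ h; have [] := h x y (hy J hJ hP).
Qed.

Lemma ideal_gen_in (P : A -> Prop) x : P x -> ideal_gen P x.
Proof. by move=> px J _; apply. Qed.

Record graded_ideal := GradedIdeal {
  gi_pred :> A -> Prop;
  gi_ideal : is_ideal gi_pred;
  gi_graded : forall a x, gi_pred x -> gi_pred (hcomp a x) }.

Lemma ideal_gen_graded (P : A -> Prop) :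
  (forall x, P x -> exists a, part a x) ->
  forall a x, ideal_gen P x -> ideal_gen P (hcomp a x).
Proof.
move=> hP a x hx; have [hs hm] := ideal_gen_ideal P.
suff : forall a, ideal_gen P (hcomp a x) by apply.
apply: (hx (fun x => forall a, ideal_gen P (hcomp a x))) => [|{x hx a}y py a].
  split=> [|{x hx a}x y hy].
    split=> [b|k y z hy hz b]; rewrite ?(lin0 (hcomp_linear b)) ?hcomp_linear.
      by case: hs.
    by case: hs => _ h; apply: (h k _ _ (hy b) (hz b)).
  by split=> b; rewrite hcomp_mul; apply: (subspaceD hs);
    [apply: (hm _ _ (hy _)).1 | apply: (hm _ _ (hy _)).1
    |apply: (hm _ _ (hy _)).2 | apply: (hm _ _ (hy _)).2].
have [b hb] := hP y py; rewrite (hcomp_part _ hb).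
by case: eqP => _; [apply: ideal_gen_in | case: hs].
Qed.

Definition homogeneous_ideal (P : A -> Prop)
    (hP : forall x, P x -> exists a, part a x) : graded_ideal :=
  GradedIdeal (ideal_gen_ideal P) (ideal_gen_graded hP).

End SuperalgebraFacts.

Section SuperQuotient.
Variables (K : fieldType) (A : superalgebra K) (J : graded_ideal A).

Definition gi_subspace : subspace A := Subspace (gi_ideal J).1.

Local Notation Q := (lquot gi_subspace).
Local Notation pi := (lpi gi_subspace).

Definition squot_part (a : bool) (q : Q) : Prop :=
  exists x, part a x /\ q = pi x.

Fact squot_part_subspace a : is_subspace (squot_part a).
Proof.
split=> [|k _ _ [x [hx ->]] [y [hy ->]]].
  by exists 0; rewrite raddf0; split=> //; apply: part0.
exists (k *: x + y); rewrite lpi_linear; split=> //.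
by apply: partD => //; apply: partZ.
Qed.

Fact squot_part_dec (q : Q) : exists q0 q1,
  [/\ squot_part false q0, squot_part true q1 & q = q0 + q1].
Proof.
exists (pi (hcomp false (lrepr q))), (pi (hcomp true (lrepr q))); split.
- by exists (hcomp false (lrepr q)); split=> //; apply: hcompP.
- by exists (hcomp true (lrepr q)); split=> //; apply: hcompP.
by rewrite -lpiD hcompD lreprK.
Qed.

Fact squot_part_disj (q : Q) : squot_part false q -> squot_part true q -> q = 0.
Proof.
move=> [x [hx ->]] [y [hy /lpi_eq h]]; apply/lpi_eq0.
have := gi_graded false h.
by rewrite (linB _ _ (hcomp_linear _)) (hcomp_id hx) (hcomp_neq hy) subr0.
Qed.

Definition squot_space : superspace K :=
  Superspace squot_part_subspace squot_part_dec squot_part_disj.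

Definition squot_mul (q r : Q) : Q := pi (smul (lrepr q) (lrepr r)).

Lemma squot_mulE x y : squot_mul (pi x) (pi y) = pi (smul x y).
Proof.
apply/lpi_eq.
have [hs hm] := gi_ideal J.
have hr z : J (lrepr (pi z) - z) by apply/(lpi_eq gi_subspace); rewrite lreprK.
rewrite /= -(subrKA (smul x (lrepr (pi y)))) -smulBl -smulBr.
by apply: (subspaceD hs); [apply: (hm _ _ (hr x)).2 | apply: (hm _ _ (hr y)).1].
Qed.

Fact squot_mul_bilinear : is_bilinear squot_mul.
Proof.
split=> [q k r s|q k r s]; rewrite -[q]lreprK -[r]lreprK -[s]lreprK.
  by rewrite -lpi_linear !squot_mulE smulDl smulZl lpi_linear.
by rewrite -lpi_linear !squot_mulE smulDr smulZr lpi_linear.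
Qed.

Fact squot_mul_part a b (q r : Q) : squot_part a q -> squot_part b r ->
  squot_part (a (+) b) (squot_mul q r).
Proof.
move=> [x [hx ->]] [y [hy ->]]; exists (smul x y).
by rewrite squot_mulE; split=> //; apply: smul_part.
Qed.

Definition squot : superalgebra K :=
  @Superalgebra K squot_space squot_mul squot_mul_bilinear squot_mul_part.

Definition squot_pi (x : A) : squot := pi x.

End SuperQuotient.

Section TensorAlgebra.
Variables (K : fieldType) (N : superspace K).

Fact tpow_lt1 n (i : 'I_n.+1) : (i.+1 < n.+2)%N.
Proof. by rewrite ltnS ltn_ord. Qed.

Fact tpow_lt2 n (i : 'I_n.+1) : (n.+1 - i < n.+2)%N.
Proof. by rewrite ltnS leq_subr. Qed.

(* T^n is the direct sum of the T^i (x) T^(n-i) for 1 <= i <= n-1; below, i is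
   shifted by one *)
Definition tpow_step (n : nat) :
    (forall m, (m < n)%N -> superspace K) -> superspace K :=
  match n with
  | 0 => fun _ => line K false
  | 1 => fun _ => N
  | n'.+2 => fun T => super_dsum (fun i : 'I_n'.+1 =>
      super_tensor (T i.+1 (tpow_lt1 i)) (T (n'.+1 - i)%N (tpow_lt2 i)))
  end.

Fact ltn_well_founded : well_founded (fun m n => (m < n)%N).
Proof.
move=> n; elim: n {-2}n (leqnn n) => [|n IH] m hm; constructor=> k hk.
  by move: (leq_trans hk hm).
by apply: IH; rewrite -ltnS (leq_trans hk).
Qed.

Definition tpow : nat -> superspace K :=
  Fix ltn_well_founded (fun _ => superspace K) tpow_step.

Fact tpowE n : tpow n = tpow_step (fun m (_ : (m < n)%N) => tpow m).
Proof.
apply: (Fix_eq ltn_well_founded (fun=> superspace K)) => m f g fg.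
congr tpow_step; apply: functional_extensionality_dep => k.
by apply: functional_extensionality_dep => h; apply: fg.
Qed.

Lemma tpow0E : tpow 0 = line K false. Proof. exact: tpowE. Qed.
Lemma tpow1E : tpow 1 = N. Proof. exact: tpowE. Qed.
Lemma tpowSSE n : tpow n.+2 =
  super_dsum (fun i : 'I_n.+1 => super_tensor (tpow i.+1) (tpow (n.+1 - i))).
Proof. exact: tpowE. Qed.

Definition scast (V W : superspace K) (e : V = W) (x : V) : W :=
  let: erefl := e in x.

Lemma scast_linear (V W : superspace K) (e : V = W) : linear (scast e).
Proof. by case: W / e. Qed.

Lemma scast_part (V W : superspace K) (e : V = W) a x :
  part a x -> part a (scast e x).
Proof. by case: W / e. Qed.

Lemma scastK (V W : superspace K) (e : V = W) : cancel (scast (esym e)) (scast e).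
Proof. by case: W / e. Qed.

Lemma scastKV (V W : superspace K) (e : V = W) :
  cancel (scast e) (scast (esym e)).
Proof. by case: W / e. Qed.

Definition tensor_space : superspace K := super_dsum tpow.

Definition tcomp n (x : tpow n) : tensor_space := @dinj K nat tpow n x.

Fact tmul_lt i j : (i < (i + j).+1)%N.
Proof. by rewrite ltnS leq_addr. Qed.

Fact tmul_sub i j : j.+1 = ((i + j).+1 - i)%N.
Proof. by rewrite -addnS addKn. Qed.

Definition tmul_pos i j (x : tpow i.+1) (y : tpow j.+1) : tpow (i + j).+2 :=
  scast (esym (tpowSSE (i + j)))
    (@dinj K 'I_(i + j).+1
       (fun k => super_tensor (tpow k.+1) (tpow ((i + j).+1 - k)))
       (Ordinal (tmul_lt i j))
       (pure x (scast (congr1 tpow (tmul_sub i j)) y))).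

Definition tmul_comp i j : tpow i -> tpow j -> tensor_space :=
  match i, j with
  | 0, j => fun x y => (scast tpow0E x : K^o) *: tcomp y
  | i.+1, 0 => fun x y => (scast tpow0E y : K^o) *: tcomp x
  | i.+1, j.+1 => fun x y => tcomp (tmul_pos x y)
  end.

Lemma tcomp_linear n : linear (@tcomp n).
Proof. exact: dinj_linear. Qed.

Fact tmul_pos_bilinear i j : is_bilinear (@tmul_pos i j).
Proof.
rewrite /tmul_pos; split=> [y k x x'|x k y y'] /=.
  have [h _] := pure_bilinear (tpow i.+1) (tpow ((i + j).+1 - i)).
  have /= -> := h (scast (congr1 tpow (tmul_sub i j)) y) k x x'.
  by rewrite dinj_linear scast_linear.
rewrite scast_linear.
have [_ h] := pure_bilinear (tpow i.+1) (tpow ((i + j).+1 - i)).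
by have /= -> := h x k (scast (congr1 tpow (tmul_sub i j)) y)
  (scast (congr1 tpow (tmul_sub i j)) y'); rewrite dinj_linear scast_linear.
Qed.

Fact tmul_comp_bilinear i j : is_bilinear (@tmul_comp i j).
Proof.
case: i j => [|i] [|j] /=; split=> [y k x x'|x k y y'] /=;
  rewrite ?scast_linear ?tcomp_linear ?(tmul_pos_bilinear i j).1
    ?(tmul_pos_bilinear i j).2 ?tcomp_linear ?scalerDl ?scalerDr ?scalerA //.
all: by rewrite [in LHS]mulrC ?scalerA.
Qed.

Definition tmul : tensor_space -> tensor_space -> tensor_space :=
  dlift2 (V := tpow) (W := tpow) tmul_comp.

Fact tmul_bilinear : is_bilinear tmul.
Proof. exact: dlift2_bilinear tmul_comp_bilinear. Qed.

Lemma line_partE a b (k : line K b) : part a k -> a = b \/ (k : K^o) = 0.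
Proof. by []. Qed.

Fact tmul_comp_part i j a b (x : tpow i) (y : tpow j) :
  part a x -> part b y -> part (a (+) b) (tmul_comp x y).
Proof.
have tc n c (z : tpow n) : part c z -> part c (tcomp z) by apply: dinj_part.
have tz n c (k : K) (z : tpow n) :
    part c z -> part c (k *: tcomp z : tensor_space).
  by move=> hz; apply: partZ; apply: tc.
have t0 n c (z : tpow n) : part c ((0 : K) *: tcomp z : tensor_space).
  by rewrite scale0r; apply: part0.
case: i j x y => [|i] [|j] x y hx hy.
- by rewrite /tmul_comp; have [->|->] := line_partE (scast_part tpow0E hx);
    [apply: tz | apply: t0].
- by rewrite /tmul_comp; have [->|->] := line_partE (scast_part tpow0E hx);
    [apply: tz | apply: t0].
- by rewrite /tmul_comp; have [->|->] := line_partE (scast_part tpow0E hy);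
    rewrite ?addbF; [apply: tz | apply: t0].
apply: tc; apply: scast_part; apply: dinj_part.
by apply: pure_part => //; apply: scast_part.
Qed.

Fact tmul_part a b (x y : tensor_space) :
  part a x -> part b y -> part (a (+) b) (tmul x y).
Proof.
move=> hx hy; apply: subspace_sum => [|i _]; first exact: part_subspace.
apply: subspace_sum => [|j _]; first exact: part_subspace.
by apply: tmul_comp_part; [apply: hx | apply: hy].
Qed.

Definition tensor_algebra : superalgebra K :=
  Superalgebra tmul_bilinear tmul_part.

Definition tone : tensor_algebra := tcomp (scast (esym tpow0E) (1 : K^o)).

Lemma tone_part : part false tone.
Proof. by apply: dinj_part; apply: scast_part; left. Qed.

Lemma smul_tonel (x : tensor_algebra) : smul tone x = x.
Proof.
have [hl hr] := tmul_bilinear.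
move: x; apply: dsum_ind => [|n x]; first exact: lin_eq (hr _) _.
rewrite /= /tmul /tone /tcomp dlift2_inj; last exact: tmul_comp_bilinear.
by rewrite /tmul_comp scastK scale1r.
Qed.

Lemma smul_toner (x : tensor_algebra) : smul x tone = x.
Proof.
have [hl hr] := tmul_bilinear.
move: x; apply: dsum_ind => [|n x]; first exact: lin_eq (hl _) _.
rewrite /= /tmul /tone /tcomp dlift2_inj; last exact: tmul_comp_bilinear.
case: n x => [|n] x; rewrite /tmul_comp; last by rewrite scastK scale1r.
rewrite -(linZ _ _ (@tcomp_linear 0)) -(linZ _ _ (scast_linear (esym tpow0E))).
congr tcomp; rewrite -[RHS](scastKV tpow0E); congr scast.
by rewrite -[_ *: _]/(_ * _) mulr1.
Qed.

Definition tin (x : N) : tensor_algebra := tcomp (scast (esym tpow1E) x).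

Lemma tin_linear : linear tin.
Proof. by move=> k x y; rewrite /tin scast_linear tcomp_linear. Qed.

Lemma tin_part a x : part a x -> part a (tin x).
Proof. by move=> hx; apply: dinj_part; apply: scast_part. Qed.

End TensorAlgebra.

Section Grassmann.
Variable K : fieldType.

(* The Grassmann algebra on generators e_0, e_1, ... : the basis element
   attached to S = {i_1 < ... < i_k} is e_S = e_{i_1} ... e_{i_k}. *)
Definition grassmann_space : superspace K :=
  super_dsum (fun S : {fset nat} => line K (odd #|` S|)).

(* the number of transpositions needed to sort the word S followed by T *)
Definition inversions (S T : {fset nat}) : nat :=
  \sum_(i <- S) \sum_(j <- T) (j < i)%N.

Definition grassmann_comp (S T : {fset nat}) (k l : K^o) : grassmann_space :=
  if [disjoint S & T]%fset then
    @dinj K {fset nat} (fun S => line K (odd #|` S|)) (S `|` T)%fset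
      ((-1) ^+ inversions S T * (k : K) * l : K^o)
  else 0.

Fact grassmann_comp_bilinear S T : is_bilinear (grassmann_comp S T).
Proof.
rewrite /grassmann_comp; split=> [l m k k'|k m l l'] /=;
  case: ifP => _; rewrite ?scaler0 ?addr0 // -dinj_linear; congr dinj.
  by rewrite mulrDr mulrDl -[m *: k]/(m * k) -[m *: (_ : K^o)]/(m * _) mulrCA !mulrA.
by rewrite mulrDr -[m *: l]/(m * l) -[m *: (_ : K^o)]/(m * _) mulrCA !mulrA.
Qed.

Definition grassmann_mul : grassmann_space -> grassmann_space -> grassmann_space :=
  dlift2 (V := fun S : {fset nat} => line K (odd #|` S|))
         (W := fun S : {fset nat} => line K (odd #|` S|)) grassmann_comp.

Fact grassmann_mul_bilinear : is_bilinear grassmann_mul.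
Proof. exact: dlift2_bilinear grassmann_comp_bilinear. Qed.

Fact grassmann_comp_part a b S T (k : line K (odd #|` S|))
    (l : line K (odd #|` T|)) :
  part a k -> part b l -> part (a (+) b) (grassmann_comp S T k l).
Proof.
rewrite /grassmann_comp; case: ifP => [/eqP dST | _ _ _]; last exact: part0.
have e : odd #|` (S `|` T)%fset| = odd #|` S| (+) odd #|` T|.
  by rewrite cardfsU dST cardfs0 subn0 oddD.
by move=> [->|->] [->|->]; apply: dinj_part; rewrite ?mulr0 ?mul0r;
  first (by left; rewrite e); right.
Qed.

Fact grassmann_mul_part a b (u v : grassmann_space) :
  part a u -> part b v -> part (a (+) b) (grassmann_mul u v).
Proof.
move=> hu hv; apply: subspace_sum => [|i _]; first exact: part_subspace.
apply: subspace_sum => [|j _]; first exact: part_subspace.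
by apply: grassmann_comp_part; [apply: hu | apply: hv].
Qed.

Definition grassmann : superalgebra K :=
  Superalgebra grassmann_mul_bilinear grassmann_mul_part.

Definition gbasis (S : {fset nat}) : grassmann :=
  @dinj K {fset nat} (fun S => line K (odd #|` S|)) S (1 : K^o).

Lemma gbasis_part S : part (odd #|` S|) (gbasis S).
Proof. by apply: dinj_part; left. Qed.

Lemma gbasis_mul S T : [disjoint S & T]%fset ->
  smul (gbasis S) (gbasis T) = (-1) ^+ inversions S T *: gbasis (S `|` T)%fset.
Proof.
move=> dST; rewrite /= /grassmann_mul /gbasis dlift2_inj; last first.
  exact: grassmann_comp_bilinear.
rewrite /grassmann_comp dST; symmetry; set V := fun S : {fset nat} => _.
apply: etrans (esym (linZ _ _ (@dinj_linear K _ V _))) _.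
by congr dinj; rewrite !mulr1 -[_ *: _]/(_ * _) mulr1.
Qed.

End Grassmann.

Section Envelope.
Variables (K : fieldType) (N : superalgebra K).

(* the (unsigned) product (g (x) x)(h (x) y) = gh (x) [x,y] on G (x) N *)
Definition envelope_mul (u v : tensor (grassmann K) N) : tensor (grassmann K) N :=
  tlift (fun (g : grassmann K) (x : N) =>
    tlift (fun (h : grassmann K) (y : N) => pure (smul g h) (smul x y)) v) u.

(* G_0 (x) N_0 + G_1 (x) N_1 *)
Definition grassmann_envelope : tensor (grassmann K) N -> Prop :=
  span (fun t => exists a (g : grassmann K) (x : N),
    [/\ part a g, part a x & t = pure g x]).

Fact envelope_inner_bilinear (g : grassmann K) (x : N) :
  is_bilinear (fun (h : grassmann K) (y : N) => pure (smul g h) (smul x y)).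
Proof.
have [hl hr] := pure_bilinear (grassmann K) N.
split=> [y k h h'|h k y y'].
  by rewrite ((smul_bilinear _).2 g) (hl (smul x y)).
by rewrite ((smul_bilinear _).2 x) (hr (smul g h)).
Qed.

Fact envelope_outer_bilinear v :
  is_bilinear (fun (g : grassmann K) (x : N) =>
    tlift (fun (h : grassmann K) (y : N) => pure (smul g h) (smul x y)) v).
Proof.
have [hl hr] := pure_bilinear (grassmann K) N.
have il g x := tlift_linear (envelope_inner_bilinear g x).
have ip g x := tlift_pure (envelope_inner_bilinear g x).
have sub (f f1 f2 : tensor (grassmann K) N -> tensor (grassmann K) N) k :
  linear f -> linear f1 -> linear f2 ->
  (forall h y, f (pure h y) = k *: f1 (pure h y) + f2 (pure h y)) ->
  f v = k *: f1 v + f2 v.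
- move=> hf h1 h2 e; apply: (tensor_ind (P := fun v => f v = k *: f1 v + f2 v)) => //.
  apply: lin_eq => // m x y; rewrite h1 h2 !scalerDr !scalerA mulrC.
  by rewrite addrACA.
split=> [x k g g'|g k x x'].
  apply: (sub _ _ _ k (il _ x) (il g x) (il g' x)) => h y.
  by rewrite !ip ((smul_bilinear _).1 h) (hl (smul x y)).
apply: (sub _ _ _ k (il g _) (il g x) (il g x')) => h y.
by rewrite !ip ((smul_bilinear _).1 y) (hr (smul g h)).
Qed.

Lemma envelope_mul_bilinear : is_bilinear envelope_mul.
Proof.
split=> [v|u]; first exact: tlift_linear (envelope_outer_bilinear v).
move=> k v w.
have ol v := tlift_linear (envelope_outer_bilinear v).
have op v := tlift_pure (envelope_outer_bilinear v).
apply: (tensor_ind (P := fun u =>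
  envelope_mul u (k *: v + w) = k *: envelope_mul u v + envelope_mul u w)).
  apply: lin_eq => [|m x y]; first exact: ol.
  by rewrite /envelope_mul !ol !scalerDr !scalerA mulrC addrACA.
move=> g x; rewrite /envelope_mul !op.
exact: (tlift_linear (envelope_inner_bilinear g x)).
Qed.

Lemma envelope_mul_pure (g h : grassmann K) (x y : N) :
  envelope_mul (pure g x) (pure h y) = pure (smul g h) (smul x y).
Proof.
rewrite /envelope_mul (tlift_pure (envelope_outer_bilinear _)).
exact: (tlift_pure (envelope_inner_bilinear g x)).
Qed.

Lemma envelope_closed u v : grassmann_envelope u -> grassmann_envelope v ->
  grassmann_envelope (envelope_mul u v).
Proof.
have sub := span_subspace (fun t => exists a (g : grassmann K) (x : N),
    [/\ part a g, part a x & t = pure g x]).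
have [bl br] := envelope_mul_bilinear.
move=> hu hv.
apply: (hu (fun u => grassmann_envelope (envelope_mul u v))).
  split=> [|k x y hx hy]; first by rewrite (lin0 (bl v)); case: sub.
  by rewrite (bl v); case: sub => _; apply.
move=> _ [a [g [x [hg hx ->]]]].
apply: (hv (fun v => grassmann_envelope (envelope_mul (pure g x) v))).
  split=> [|k y z hy hz]; first by rewrite (lin0 (br _)); case: sub.
  by rewrite (br (pure g x)); case: sub => _; apply.
move=> _ [b [h [y [hh hy ->]]]]; rewrite envelope_mul_pure; apply: span_gen.
by exists (a (+) b), (smul g h), (smul x y); split=> //; apply: smul_part.
Qed.

End Envelope.

(* E, with the product mul, is a Malcev algebra *)
Definition is_malcev (K : fieldType) (V : lmodType K) (mul : V -> V -> V)
    (E : V -> Prop) : Prop :=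
  let J x y z := mul (mul x y) z + mul (mul y z) x + mul (mul z x) y in
  (forall x, E x -> mul x x = 0) /\
  (forall x y z, E x -> E y -> E z -> J x y (mul x z) = mul (J x y z) x).

Record malcev_superalgebra (K : fieldType) := MalcevSuperalgebra {
  ms_alg :> superalgebra K;
  ms_malcev : is_malcev (@envelope_mul K ms_alg) (grassmann_envelope (N := ms_alg)) }.

Section SuperJacobian.
Variables (K : fieldType) (N : superalgebra K).
Local Notation "[ x , y ]" := (smul x y) (at level 0).

(* only meaningful for x, y, z of respective parities a, b, c *)
Definition superjac_hom (a b c : bool) (x y z : N) : N :=
  [[x, y], z] + sgn (a && (b (+) c)) *: [[y, z], x]
              + sgn (c && (a (+) b)) *: [[z, x], y].

(* the trilinear map agreeing with superjac_hom a b c on homogeneous elements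
   of parities a, b, c (superjacE) *)
Definition superjac (x y z : N) : N :=
  \sum_(a : bool) \sum_(b : bool) \sum_(c : bool)
    superjac_hom a b c (hcomp a x) (hcomp b y) (hcomp c z).

End SuperJacobian.

Definition is_trilinear (K : fieldType) (V W : lmodType K)
    (f : V -> V -> V -> W) : Prop :=
  [/\ forall y z, linear (fun x => f x y z), forall x z, linear (fun y => f x y z)
    & forall x y, linear (f x y)].

Record akivis_superalgebra (K : fieldType) := AkivisSuperalgebra {
  ak_alg :> superalgebra K;
  ak_op : ak_alg -> ak_alg -> ak_alg -> ak_alg;
  ak_trilinear : is_trilinear ak_op;
  ak_part : forall a b c x y z, part a x -> part b y -> part c z ->
    part (a (+) b (+) c) (ak_op x y z);
  ak_anticomm : forall a b (x y : ak_alg), part a x -> part b y ->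
    smul x y = - (sgn (a && b) *: smul y x);
  ak_identity : forall a b c x y z, part a x -> part b y -> part c z ->
    superjac_hom a b c x y z =
      ak_op x y z
      + sgn (a && (b (+) c)) *: ak_op y z x
      + sgn (c && (a (+) b)) *: ak_op z x y
      - sgn (a && b) *: ak_op y x z
      - sgn (b && c) *: ak_op x z y
      - sgn ((a && b) (+) (a && c) (+) (b && c)) *: ak_op z y x }.

Section SuperJacobianFacts.
Variables (K : fieldType) (N : superalgebra K).

Let lin_add (U V : lmodType K) (f g : U -> V) :
  linear f -> linear g -> linear (fun x => f x + g x).
Proof. by move=> hf hg k x y; rewrite hf hg scalerDr addrACA. Qed.

Let lin_scale (U V : lmodType K) (f : U -> V) l :
  linear f -> linear (fun x => l *: f x).
Proof. by move=> hf k x y; rewrite hf scalerDr !scalerA mulrC. Qed.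

Let lin_bigsum (I : finType) (U V : lmodType K) (f : I -> U -> V) :
  (forall i, linear (f i)) -> linear (fun x => \sum_i f i x).
Proof.
move=> hf k x y; rewrite scaler_sumr -big_split.
by apply: eq_bigr => i _; apply: hf.
Qed.

Let lin_comp (U V W : lmodType K) (f : U -> V) (g : V -> W) :
  linear f -> linear g -> linear (fun x => g (f x)).
Proof. by move=> hf hg k x y; rewrite hf hg. Qed.

Lemma superjac_hom_trilinear a b c : is_trilinear (@superjac_hom K N a b c).
Proof.
have [hl hr] := smul_bilinear N.
have l2 y z : linear (fun x : N => smul (smul x y) z).
  exact: (lin_comp (hl y) (hl z)).
have l1 y z : linear (fun x : N => smul (smul y x) z).
  exact: (lin_comp (hr y) (hl z)).
by split=> ? ?; apply: lin_add; do ?[apply: lin_add | apply: lin_scale].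
Qed.

Lemma superjac_trilinear : is_trilinear (@superjac K N).
Proof.
have h a b c := superjac_hom_trilinear a b c.
split=> [y z|x z|x y]; apply: lin_bigsum => a; apply: lin_bigsum => b;
  apply: lin_bigsum => c; have [h1 h2 h3] := h a b c.
- exact: (lin_comp (hcomp_linear a) (h1 _ _)).
- exact: (lin_comp (hcomp_linear b) (h2 _ _)).
- exact: (lin_comp (hcomp_linear c) (h3 _ _)).
Qed.

Lemma superjacE a b c (x y z : N) : part a x -> part b y -> part c z ->
  superjac x y z = superjac_hom a b c x y z.
Proof.
move=> hx hy hz; rewrite /superjac.
rewrite (bigD1 a) //= [X in _ + X]big1 ?addr0; last first.
  move=> a' na; apply: big1 => b' _; apply: big1 => c' _.
  have [h _ _] := superjac_hom_trilinear a' b' c'.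
  by rewrite (hcomp_part _ hx) eq_sym (negPf na) (lin0 (h _ _)).
rewrite (bigD1 b) //= [X in _ + X]big1 ?addr0; last first.
  move=> b' nb; apply: big1 => c' _.
  have [_ h _] := superjac_hom_trilinear a b' c'.
  by rewrite (hcomp_part _ hy) eq_sym (negPf nb) (lin0 (h _ _)).
rewrite (bigD1 c) //= [X in _ + X]big1 ?addr0 ?hcomp_id // => c' nc.
have [_ _ h] := superjac_hom_trilinear a b c'.
by rewrite (hcomp_part _ hz) eq_sym (negPf nc) (lin0 (h _ _)).
Qed.

Lemma superjac_hom_part a b c (x y z : N) : part a x -> part b y -> part c z ->
  part (a (+) b (+) c) (superjac_hom a b c x y z).
Proof.
move=> hx hy hz; do 2?[apply: partD].
- by do !apply: smul_part.
- by apply: partZ; rewrite -addbA addbC; do !apply: smul_part.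
by apply: partZ; rewrite addbC addbA; do !apply: smul_part.
Qed.

Lemma smulNl (x y : N) : smul (- x) y = - smul x y.
Proof. exact: (linN x ((smul_bilinear N).1 y)). Qed.

Section Swap.
Hypothesis ac : forall a b (x y : N), part a x -> part b y ->
  smul x y = - (sgn (a && b) *: smul y x).
Variables (a b c : bool) (x y z : N).
Hypotheses (hx : part a x) (hy : part b y) (hz : part c z).

Lemma superjac_swap12 :
  superjac_hom b a c y x z = - (sgn (a && b) *: superjac_hom a b c x y z).
Proof.
rewrite /superjac_hom (ac hy hx) (ac hx hz) (ac hz hy) !smulNl !smulZl.
by case: (a); case: (b); case: (c); rewrite /sgn /= ?expr1 ?expr0 !(scaleN1r, scale1r, smulNl, opprK, opprD) addrAC.
Qed.

Lemma superjac_swap23 :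
  superjac_hom a c b x z y = - (sgn (b && c) *: superjac_hom a b c x y z).
Proof.
rewrite /superjac_hom (ac hy hx) (ac hx hz) (ac hz hy) !smulNl !smulZl.
by case: (a); case: (b); case: (c); rewrite /sgn /= ?expr1 ?expr0 !(scaleN1r, scale1r, smulNl, opprK, opprD)
  [in LHS]addrC [X in _ + X = _]addrC addrA.
Qed.

End Swap.

End SuperJacobianFacts.

Section MalcevAkivis.
Variables (K : fieldType) (N : malcev_superalgebra K).

Lemma malcev_anticomm a b (x y : N) : part a x -> part b y ->
  smul x y = - (sgn (a && b) *: smul y x).
Proof.
move=> hx hy; have [sq _] := ms_malcev N.
have [bl br] := envelope_mul_bilinear N.
pose S : {fset nat} := if a then [fset 0%N]%fset else fset0.
pose T : {fset nat} := if b then [fset 1%N]%fset else fset0.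
have hS : odd #|` S| = a by rewrite /S; case: (a); rewrite ?cardfs1 ?cardfs0.
have hT : odd #|` T| = b by rewrite /T; case: (b); rewrite ?cardfs1 ?cardfs0.
have dST : [disjoint S & T]%fset.
  apply/fdisjointP => i; rewrite /S /T; case: (a) => //; case: (b) => //.
  by rewrite !inE => /eqP ->.
have iST : inversions S T = 0%N.
  rewrite /inversions /S /T; case: (a); last by rewrite big_nil.
  by rewrite big_seq_fset1; case: (b); rewrite ?big_seq_fset1 ?big_nil.
have iTS : inversions T S = (a && b).
  rewrite /inversions /S /T; case: (b); last by rewrite big_nil andbF.
  by rewrite big_seq_fset1; case: (a); rewrite ?big_seq_fset1 ?big_nil.
have gS := gbasis_part K S; have gT := gbasis_part K T; rewrite hS hT in gS gT.
pose u := pure (gbasis K S) x; pose v := pure (gbasis K T) y.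
have eu : grassmann_envelope (N := N) u.
  by apply: span_gen; exists a, (gbasis K S), x.
have ev : grassmann_envelope (N := N) v.
  by apply: span_gen; exists b, (gbasis K T), y.
have uv : envelope_mul u v + envelope_mul v u = 0.
  have h : grassmann_envelope (N := N) (u + v).
    exact: (subspaceD (span_subspace _) eu ev).
  have := sq _ h; rewrite (linD _ _ (bl _)) !(linD _ _ (br _)) (sq _ eu) (sq _ ev).
  by rewrite add0r addr0.
pose f (g : grassmann K) (w : N) : N := (g (S `|` T)%fset : K^o) *: w.
have hf : is_bilinear f.
  split=> [w k g g'|g k w w']; rewrite /f /=; first by rewrite scalerDl scalerA.
  by rewrite scalerDr !scalerA mulrC.
have : tlift f (envelope_mul u v + envelope_mul v u) = 0.
  by rewrite uv (lin0 (tlift_linear hf)).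
rewrite (linD _ _ (tlift_linear hf)) !envelope_mul_pure !(tlift_pure hf).
rewrite gbasis_mul // gbasis_mul; last by rewrite fdisjoint_sym.
rewrite iST iTS [(T `|` S)%fset]fsetUC /f.
have e k : ((k *: gbasis K (S `|` T)%fset) (S `|` T)%fset : K^o) = k.
  by rewrite -[LHS]/(k * _) dinj_eq mulr1.
by rewrite !e expr0 scale1r => /eqP; rewrite addr_eq0 => /eqP.
Qed.

Definition malcev_akivis_op (x y z : N) : N := 6%:R^-1 *: superjac x y z.

Fact malcev_akivis_trilinear : is_trilinear malcev_akivis_op.
Proof.
have [h1 h2 h3] := superjac_trilinear N.
by split=> [y z|x z|x y] k v w; rewrite /malcev_akivis_op ?h1 ?h2 ?h3;
  rewrite scalerDr !scalerA mulrC.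
Qed.

Fact malcev_akivis_part a b c (x y z : N) :
  part a x -> part b y -> part c z ->
  part (a (+) b (+) c) (malcev_akivis_op x y z).
Proof.
move=> hx hy hz; apply: partZ; rewrite (superjacE hx hy hz).
exact: superjac_hom_part.
Qed.

Hypotheses (K2 : 2%N \notin [pchar K]) (K3 : 3%N \notin [pchar K]).

Let K6 : (6%:R : K) != 0.
Proof.
by rewrite (natrM K 2 3); apply: mulf_neq0; [move: K2 | move: K3]; rewrite inE.
Qed.

Fact malcev_akivis_identity a b c (x y z : N) :
  part a x -> part b y -> part c z ->
  superjac_hom a b c x y z =
      malcev_akivis_op x y z
      + sgn (a && (b (+) c)) *: malcev_akivis_op y z x
      + sgn (c && (a (+) b)) *: malcev_akivis_op z x y
      - sgn (a && b) *: malcev_akivis_op y x z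
      - sgn (b && c) *: malcev_akivis_op x z y
      - sgn ((a && b) (+) (a && c) (+) (b && c)) *: malcev_akivis_op z y x.
Proof.
move=> hx hy hz; rewrite /malcev_akivis_op.
rewrite (superjacE hx hy hz) (superjacE hy hz hx) (superjacE hz hx hy).
rewrite (superjacE hy hx hz) (superjacE hx hz hy) (superjacE hz hy hx).
have s12 := superjac_swap12 malcev_anticomm.
have s23 := superjac_swap23 malcev_anticomm.
rewrite (s12 _ _ _ _ _ _ hy hz hx) (s23 _ _ _ _ _ _ hy hx hz).
rewrite (s12 _ _ _ _ _ _ hx hz hy) (s12 _ _ _ _ _ _ hx hy hz).
rewrite (s23 _ _ _ _ _ _ hx hy hz).
set S := superjac_hom a b c x y z; set k := 6%:R^-1.
have e : S = (k *: S) *+ 6 by rewrite -scaler_nat scalerA divff // scale1r.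
rewrite [LHS]e; move: S e => S _.
by case: (a); case: (b); case: (c); rewrite /sgn /= ?expr1 ?expr0;
  rewrite !(scaleN1r, scale1r, opprK, scalerN) -!addrA.
Qed.

Definition malcev_akivis : akivis_superalgebra K :=
  @AkivisSuperalgebra K N malcev_akivis_op malcev_akivis_trilinear
    malcev_akivis_part malcev_anticomm malcev_akivis_identity.

End MalcevAkivis.

Section AkivisEnvelope.
Variables (K : fieldType) (M : akivis_superalgebra K).

Inductive akivis_gen : tensor_algebra M -> Prop :=
| AkivisComm a b (x y : M) : part a x -> part b y ->
    akivis_gen (smul (tin x) (tin y) - sgn (a && b) *: smul (tin y) (tin x)
                - tin (smul x y))
| AkivisAssoc a b c (x y z : M) : part a x -> part b y -> part c z ->
    akivis_gen (associator (tin x) (tin y) (tin z) - tin (ak_op x y z)).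

Fact comm_gen_part (N : superalgebra K) a b (x y : N) :
  part a x -> part b y ->
  part (a (+) b) (smul (tin x) (tin y) - sgn (a && b) *: smul (tin y) (tin x)
                  - tin (smul x y)).
Proof.
move=> hx hy; have := (tin_part hx, tin_part hy) => -[tx ty].
apply: partB; last by apply: tin_part; apply: smul_part.
by apply: partB; [|apply: partZ; rewrite addbC]; apply: smul_part.
Qed.

Fact akivis_gen_homogeneous t : akivis_gen t -> exists a, part a t.
Proof.
case=> [a b x y hx hy|a b c x y z hx hy hz].
  by exists (a (+) b); apply: comm_gen_part.
exists (a (+) b (+) c); apply: partB; last by apply: tin_part; apply: ak_part.
by apply: associator_part; apply: tin_part.
Qed.

Definition akivis_ideal : graded_ideal (tensor_algebra M) :=
  homogeneous_ideal akivis_gen_homogeneous.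

Definition akivis_envelope : superalgebra K := squot akivis_ideal.

End AkivisEnvelope.

Section MalcevEnvelope.
Variables (K : fieldType) (N : malcev_superalgebra K).
Local Notation T := (tensor_algebra N).

Inductive malcev_gen : T -> Prop :=
| MalcevComm a b (x y : N) : part a x -> part b y ->
    malcev_gen (smul (tin x) (tin y) - sgn (a && b) *: smul (tin y) (tin x)
                - tin (smul x y))
| MalcevAltl a c d (n : N) (x y : T) : part a n -> part c x -> part d y ->
    malcev_gen (associator (tin n) x y + sgn (a && c) *: associator x (tin n) y)
| MalcevAltr a c d (n : N) (x y : T) : part a n -> part c x -> part d y ->
    malcev_gen (associator x (tin n) y + sgn (a && d) *: associator x y (tin n)).

Fact malcev_gen_homogeneous t : malcev_gen t -> exists a, part a t.
Proof.
case=> [a b x y hx hy|a c d n x y /tin_part hn hx hy|a c d n x y /tin_part hn hx hy].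
- by exists (a (+) b); apply: comm_gen_part.
- exists (a (+) c (+) d); apply: partD; first exact: associator_part.
  by apply: partZ; rewrite (addbC a); apply: associator_part.
exists (c (+) a (+) d); apply: partD; first exact: associator_part.
by apply: partZ; rewrite addbAC; apply: associator_part.
Qed.

Definition malcev_ideal : graded_ideal T :=
  homogeneous_ideal malcev_gen_homogeneous.

Definition malcev_envelope : superalgebra K := squot malcev_ideal.

End MalcevEnvelope.

(* Main.v *)
Require Import Defs.
From mathcomp Require Import all_boot ssralg.

Set Implicit Arguments.
Unset Strict Implicit.
Unset Printing Implicit Defensive.

Import GRing.Theory.
Local Open Scope ring_scope.

(** Modulo the supercommutator relations, the image of the superjacobian is the
    signed sum of the six permuted associators.  In the classical envelope the
    associator is super-alternating on [N], so the six terms agree and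
    [SJ(x,y,z) = 6 (x,y,z)] there: the Akivis relations hold. *)

(* The final [+ 0] keeps every term to the left of some sum, so that [addrCA] can
   move the opposite of the leading term to the front. *)
Ltac cancel_terms :=
  apply: subr0_eq; rewrite -[LHS]addr0;
  rewrite ?(opprD, opprK) -?addrA;
  repeat lazymatch goal with
  | |- - ?t + _ = 0 => repeat rewrite (addrCA _ t); rewrite addNKr
  | |- ?t + _ = 0 => repeat rewrite (addrCA _ (- t)); rewrite addKr
  end.

Section SuperAkivis.
Variables (K : fieldType) (N A : superalgebra K) (f : N -> A).
Hypotheses (f_linear : linear f)
  (f_comm : forall a b (x y : N), part a x -> part b y ->
     f (smul x y) = smul (f x) (f y) - sgn (a && b) *: smul (f y) (f x)).
Variables (a b c : bool) (x y z : N).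
Hypotheses (hx : part a x) (hy : part b y) (hz : part c z).

(** By [f_comm] each of the three double brackets opens into four triple products, and the twelve
    products are exactly those occurring in the six associators. The signs are compared for each of
    the eight choices of parities. *)
Lemma superjac_associator : f (superjac_hom a b c x y z) =
  associator (f x) (f y) (f z)
  + sgn (a && (b (+) c)) *: associator (f y) (f z) (f x)
  + sgn (c && (a (+) b)) *: associator (f z) (f x) (f y)
  - sgn (a && b) *: associator (f y) (f x) (f z)
  - sgn (b && c) *: associator (f x) (f z) (f y)
  - sgn ((a && b) (+) (a && c) (+) (b && c)) *: associator (f z) (f y) (f x).
Proof.
rewrite /superjac_hom !(linD _ _ f_linear) !(linZ _ _ f_linear).
rewrite (f_comm (smul_part hx hy) hz) (f_comm (smul_part hy hz) hx).
rewrite (f_comm (smul_part hz hx) hy) (f_comm hx hy) (f_comm hy hz).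
rewrite (f_comm hz hx) /associator.
rewrite !(smulBl, smulBr, smulZl, smulZr).
case: (a); case: (b); case: (c); rewrite /sgn /= ?expr1 ?expr0.
all: rewrite !(scaleN1r, scale1r, opprK).
all: by cancel_terms.
Qed.

Hypothesis f_alt12 : forall a b c (x y z : N), part a x -> part b y -> part c z ->
  associator (f x) (f y) (f z) = - (sgn (a && b) *: associator (f y) (f x) (f z)).
Hypothesis f_alt23 : forall a b c (x y z : N), part a x -> part b y -> part c z ->
  associator (f x) (f y) (f z) = - (sgn (b && c) *: associator (f x) (f z) (f y)).

Lemma superjac_associator6 :
  f (superjac_hom a b c x y z) = 6%:R *: associator (f x) (f y) (f z).
Proof.
(* Each swap also acts on terms produced by earlier ones: zyx goes to yzx, yxz, xyz, and zxy goes to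
   xzy, xyz. *)
rewrite superjac_associator (f_alt12 hz hy hx).
rewrite (f_alt23 hy hz hx) (f_alt12 hz hx hy).
rewrite (f_alt23 hx hz hy) (f_alt12 hy hx hz).
rewrite scaler_nat; move: (associator _ _ _) => t.
case: (a); case: (b); case: (c); rewrite /sgn /= ?expr1 ?expr0.
all: by rewrite !(scaleN1r, scale1r, opprK, scalerN) -!addrA.
Qed.

End SuperAkivis.

Section QuotientMap.
Variables (K : fieldType) (A : superalgebra K) (I J : graded_ideal A).
Hypothesis IJ : forall x, I x -> J x.

(** The value is computed on the representative chosen by [lrepr]; [squot_map_pi] shows that any
    other representative gives the same class. *)
Definition squot_map (q : squot I) : squot J :=
  squot_pi J (lrepr (q : lquot (gi_subspace I))).

Lemma squot_map_pi x : squot_map (squot_pi I x) = squot_pi J x.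
Proof.
(* The chosen representative of the class of [x] differs from [x] by an element of [I], hence of
   [J]. *)
apply/lpi_eq/IJ; change (gi_subspace I (lrepr (lpi (gi_subspace I) x) - x)).
by apply/lpi_eq; rewrite lreprK.
Qed.

Lemma squot_pi_surj (q : squot I) : exists x, q = squot_pi I x.
Proof. by exists (lrepr (q : lquot (gi_subspace I))); rewrite -[LHS]lreprK. Qed.

Lemma squot_pi_linear : linear (squot_pi J).
Proof. exact: lpi_linear. Qed.

Lemma squot_pi_mul x y :
  squot_pi J (smul x y) = smul (squot_pi J x) (squot_pi J y).
Proof. by rewrite /= squot_mulE. Qed.

Lemma squot_pi_associator x y z :
  squot_pi J (associator x y z) =
  associator (squot_pi J x) (squot_pi J y) (squot_pi J z).
Proof. by rewrite /associator (linB _ _ squot_pi_linear) !squot_pi_mul. Qed.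

End QuotientMap.

Lemma squot_map_hom (K : fieldType) (A : superalgebra K) (I J : graded_ideal A) :
  (forall x, I x -> J x) -> superalgebra_hom (@squot_map K A I J).
Proof.
move=> IJ; have E := squot_map_pi IJ; split=> [k p q|p q|a _ [x [hx ->]]].
- have [x ->] := squot_pi_surj p; have [y ->] := squot_pi_surj q.
  by rewrite -squot_pi_linear !E squot_pi_linear.
- have [x ->] := squot_pi_surj p; have [y ->] := squot_pi_surj q.
  by rewrite -squot_pi_mul !E squot_pi_mul.
(* A class of parity [a] comes with a representative [x] of parity [a], which serves for the image
   as well. *)
by exists x; rewrite -/(squot_pi I x) E.
Qed.

Section MalcevEnvelopeRelations.
Variables (K : fieldType) (N : malcev_superalgebra K).

Definition malcev_in (x : N) : malcev_envelope N :=
  squot_pi (malcev_ideal N) (tin x).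

Lemma malcev_gen_pi t : malcev_gen t -> squot_pi (malcev_ideal N) t = 0.
Proof.
move=> ht; apply/(lpi_eq0 (gi_subspace (malcev_ideal N))).
exact: (ideal_gen_in ht).
Qed.

Lemma malcev_in_linear : linear malcev_in.
Proof. by move=> k x y; rewrite /malcev_in tin_linear squot_pi_linear. Qed.

Lemma malcev_in_comm a b (x y : N) : part a x -> part b y ->
  malcev_in (smul x y) = smul (malcev_in x) (malcev_in y)
    - sgn (a && b) *: smul (malcev_in y) (malcev_in x).
Proof.
move=> hx hy; have := malcev_gen_pi (MalcevComm hx hy).
have L := squot_pi_linear (malcev_ideal N).
rewrite !(linB _ _ L) (linZ _ _ L) !squot_pi_mul.
by move/eqP; rewrite subr_eq0 => /eqP /esym.
Qed.

(** This is the first family of alternating generators, with all three arguments of tensor degree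
    one. *)
Lemma malcev_in_alt12 a b c (x y z : N) : part a x -> part b y -> part c z ->
  associator (malcev_in x) (malcev_in y) (malcev_in z) =
  - (sgn (a && b) *: associator (malcev_in y) (malcev_in x) (malcev_in z)).
Proof.
move=> hx hy hz.
have := malcev_gen_pi (MalcevAltl hx (tin_part hy) (tin_part hz)).
have L := squot_pi_linear (malcev_ideal N).
rewrite (linD _ _ L) (linZ _ _ L) !squot_pi_associator.
by move/eqP; rewrite addr_eq0 => /eqP.
Qed.

Lemma malcev_in_alt23 a b c (x y z : N) : part a x -> part b y -> part c z ->
  associator (malcev_in x) (malcev_in y) (malcev_in z) =
  - (sgn (b && c) *: associator (malcev_in x) (malcev_in z) (malcev_in y)).
Proof.
move=> hx hy hz.
(* The distinguished element of [N] in the generator is the middle argument [y], which moves past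
   [z]. *)
have := malcev_gen_pi (MalcevAltr hy (tin_part hx) (tin_part hz)).
have L := squot_pi_linear (malcev_ideal N).
rewrite (linD _ _ L) (linZ _ _ L) !squot_pi_associator.
by move/eqP; rewrite addr_eq0 => /eqP.
Qed.

Hypotheses (K2 : 2%N \notin [pchar K]) (K3 : 3%N \notin [pchar K]).

(** In the envelope the superjacobian is six times the associator, and 6 = 2 * 3 is invertible in
    [K]. *)
Lemma malcev_in_associator a b c (x y z : N) :
  part a x -> part b y -> part c z ->
  associator (malcev_in x) (malcev_in y) (malcev_in z) =
  malcev_in (malcev_akivis_op x y z).
Proof.
move=> hx hy hz; rewrite /malcev_akivis_op (superjacE hx hy hz).
have K6 : (6%:R : K) != 0.
  by rewrite (natrM K 2 3); apply: mulf_neq0; [move: K2 | move: K3]; rewrite inE.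
rewrite (linZ _ _ malcev_in_linear) (superjac_associator6 malcev_in_linear
  malcev_in_comm hx hy hz malcev_in_alt12 malcev_in_alt23).
by rewrite scalerA mulVf // scale1r.
Qed.

Lemma akivis_ideal_sub_malcev (n : tensor_algebra N) :
  akivis_ideal (malcev_akivis N K2 K3) n -> malcev_ideal N n.
Proof.
(* Membership in a generated ideal quantifies over all ideals containing the generators; it is
   instantiated at [malcev_ideal N], leaving the two kinds of Akivis generators. *)
apply; first exact: gi_ideal.
move=> _ [a b x y hx hy|a b c x y z hx hy hz].
  exact: (ideal_gen_in (MalcevComm hx hy)).
apply/(lpi_eq (gi_subspace (malcev_ideal N))).
rewrite -/(squot_pi (malcev_ideal N) _) squot_pi_associator.
exact: (malcev_in_associator hx hy hz).
Qed.

End MalcevEnvelopeRelations.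

Theorem mainTheorem5 (K : fieldType)
    (K2 : 2%N \notin [pchar K]) (K3 : 3%N \notin [pchar K])
    (N : malcev_superalgebra K) :
  let M : akivis_superalgebra K := malcev_akivis N K2 K3 in
  (forall n : tensor_algebra N, akivis_ideal M n -> malcev_ideal N n) /\
  (exists mu : akivis_envelope M -> malcev_envelope N,
    [/\ superalgebra_hom mu,
        forall v : malcev_envelope N, exists u : akivis_envelope M, mu u = v
      & forall n : tensor_algebra N,
          mu (squot_pi (akivis_ideal M) n) = squot_pi (malcev_ideal N) n]).
Proof.
move=> M; have IJ := @akivis_ideal_sub_malcev K N K2 K3; split=> //.
exists (@squot_map K _ (akivis_ideal M) (malcev_ideal N)).
split=> [|v|n]; [exact: squot_map_hom | | exact: squot_map_pi].
have [x ->] := squot_pi_surj v; exists (squot_pi (akivis_ideal M) x).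
exact: squot_map_pi.
Qed.
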